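(* Let $G$ be a finite bipartite graph with complete bipartite components, with all multiplicity spaces equal to $\mathbb C$, let $\mathcal H^\circ_{\mathbf S}$, $\mathcal H^\circ_{\mathbf R}$, $\boldsymbol\Delta_{\mathbf G^\circ}$ and $\boldsymbol\Delta_{\overline{\mathbf G}}$ be the associated spaces and structures defined in the context, and let $M^\circ$ be any operator from $\mathcal H^\circ_{\mathbf S}$ into $\mathcal H^\circ_{\mathbf R}$. Then $$\widetilde\mu_{\boldsymbol\Delta_{\mathbf G^\circ}}(M^\circ):=\mu_{\boldsymbol\Delta_{\overline{\mathbf G}}}(I_{\mathcal H^\circ_{\mathbf S}}\otimes M^\circ)=\widehat\mu_{\boldsymbol\Delta_{\mathbf G^\circ}}(M^\circ).$$
   Context: All spaces are complex; $\mathcal L(\mathcal H,\mathcal K)$ denotes the bounded linear operators from $\mathcal H$ to $\mathcal K$. $G$ is a finite simple undirected bipartite graph with vertex set $\mathbf S\sqcup\mathbf R$ (source and range vertices), every edge joining $\mathbf S$ to $\mathbf R$, such that each path-connected component is a complete bipartite graph (having at least one source and at least one range vertex). $\mathbf P$ is the set of path-connected components; $\mathbf S_p$, $\mathbf R_p$ are the source and range vertices in $p\in\mathbf P$. Put $$\mathcal H^\circ_{\mathbf S,p}=\mathbb C^{\mathbf S_p},\quad \mathcal H^\circ_{\mathbf R,p}=\mathbb C^{\mathbf R_p},\quad \mathcal H^\circ_{\mathbf S}=\bigoplus_p\mathcal H^\circ_{\mathbf S,p},\quad \mathcal H^\circ_{\mathbf R}=\bigoplus_p\mathcal H^\circ_{\mathbf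 R,p}.$$ The structure is $\boldsymbol\Delta_{\mathbf G^\circ}=\{\mathrm{diag}_{p\in\mathbf P}\,W_p:\ W_p\in\mathcal L(\mathcal H^\circ_{\mathbf R,p},\mathcal H^\circ_{\mathbf S,p})\}$, and the enhanced structure is $$\boldsymbol\Delta_{\overline{\mathbf G}}=\{\mathrm{diag}_{p\in\mathbf P}\,W_p:\ W_p\in\mathcal L(\mathcal H^\circ_{\mathbf S}\otimes\mathcal H^\circ_{\mathbf R,p},\ \mathcal H^\circ_{\mathbf S}\otimes\mathcal H^\circ_{\mathbf S,p})\}\subset\mathcal L(\mathcal H^\circ_{\mathbf S}\otimes\mathcal H^\circ_{\mathbf R},\ \mathcal H^\circ_{\mathbf S}\otimes\mathcal H^\circ_{\mathbf S}).$$ For a structure $\boldsymbol\Delta\subset\mathcal L(\mathcal X_{\mathbf R},\mathcal X_{\mathbf S})$ and $M\in\mathcal L(\mathcal X_{\mathbf S},\mathcal X_{\mathbf R})$, $$\mu_{\boldsymbol\Delta}(M)=\frac1{\inf\{\|\Delta\|:\ \Delta\in\boldsymbol\Delta,\ 1\in\sigma(M\Delta)\}}$$ (value $0$ if the set is empty), and $\widehat\mu_{\boldsymbol\Delta}(M)=\inf\{\|XMY^{-1}\|:(X,Y)\in\boldsymbol\Delta',\ X,Y\text{ invertible}\}$, where $\boldsymbol\Delta'=\{(X,Y)\in\mathcal L(\mathcal X_{\mathbf R})\times\mathcal L(\mathcal X_{\mathbf S}):\ \Delta X=Y\Delta\ \text{for all }\Delta\in\boldsymbol\Delta\}$. For $\boldsymbol\Delta_{\mathbf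 G^\circ}$, the set $\boldsymbol\Delta_{\mathbf G^\circ}'$ consists of the pairs $X=\bigoplus_p\gamma_pI_{\mathcal H^\circ_{\mathbf R,p}}$, $Y=\bigoplus_p\gamma_pI_{\mathcal H^\circ_{\mathbf S,p}}$ with $\gamma_p\in\mathbb C$. *)

(* Defs.v *)
From mathcomp Require Import all_boot all_order all_algebra.
From mathcomp Require Import complex mxtens.
From mathcomp Require Import boolp classical_sets reals.

Set Implicit Arguments.
Unset Strict Implicit.
Unset Printing Implicit Defensive.

Import Order.TTheory GRing.Theory Num.Theory.

Local Open Scope classical_set_scope.
Local Open Scope ring_scope.
Local Open Scope complex_scope.

(* Operators C^n -> C^m are matrices 'M[R[i]]_(m, n) acting on column vectors,
   and tensor products are Kronecker products A *t B. *)

Section OperatorNorm.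
Variable R : realType.

Definition l2norm n (v : 'cV[R[i]]_n) : R :=
  Num.sqrt (\sum_(k < n) (complex.Re `|v k 0|) ^+ 2).

Definition opnorm m n (A : 'M[R[i]]_(m, n)) : R :=
  sup [set l2norm (A *m v) | v in [set v : 'cV[R[i]]_n | l2norm v <= 1]].

Definition spectrum n (A : 'M[R[i]]_n) : set R[i] :=
  [set l | l%:M - A \notin unitmx].

End OperatorNorm.

Section StructuredSingularValue.
Variables (R : realType) (r s : nat).

(* A structure D is a set of operators from X_R = C^r to X_S = C^s. *)
Implicit Types (D : set 'M[R[i]]_(s, r)) (M : 'M[R[i]]_(r, s)).

Definition destabilizing D M : set 'M[R[i]]_(s, r) :=
  [set W | D W /\ spectrum (M *m W) 1].

Definition mu D M : R :=
  if `[< destabilizing D M = set0 >] then 0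
  else 1 / inf [set opnorm W | W in destabilizing D M].

Definition commutant D : set ('M[R[i]]_r * 'M[R[i]]_s) :=
  [set XY | forall W, D W -> W *m XY.1 = XY.2 *m W].

Definition mu_hat D M : R :=
  inf [set opnorm (XY.1 *m M *m invmx XY.2) | XY in
        [set XY | [/\ commutant D XY, XY.1 \in unitmx & XY.2 \in unitmx]]].

End StructuredSingularValue.

(* Graphs on the disjoint union of the sources S and the ranges T, given by
   their adjacency relation. *)
Section BipartiteGraph.
Variables (S T : finType).
Implicit Types (e : rel (S + T)%type) (p : {set (S + T)%type}).

Definition bipartite e : Prop :=
  [/\ symmetric e,
      forall s s', ~~ e (inl s) (inl s') &
      forall t t', ~~ e (inr t) (inr t')].

Definition components e : {set {set (S + T)%type}} :=
  equivalence_partition (connect e) [set: (S + T)%type]%SET.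

Definition sources p : {set S} := [set s | inl s \in p]%SET.
Definition ranges p : {set T} := [set t | inr t \in p]%SET.

Definition complete_components e : Prop :=
  forall p, p \in components e ->
    [/\ exists s, s \in sources p,
        exists t, t \in ranges p &
        forall s t, s \in sources p -> t \in ranges p -> e (inl s) (inr t)].

End BipartiteGraph.

(* C^I is 'cV_#|I| and, for A : {set I}, C^A is 'cV_#|A|, with bases indexed
   through enum_val; [incl A] is the isometric inclusion of C^A into C^I and its
   transpose is the orthogonal projection onto C^A. *)
Definition incl (R : realType) (I : finType) (A : {set I}) :
    'M[R[i]]_(#|I|, #|A|) :=
  \matrix_(k, l) ((enum_val k : I) == enum_val l)%:R.

Section GraphStructures.
Variables (R : realType) (S T : finType) (e : rel (S + T)%type).

(* diag_p W_p relative to C^S = (+)_p C^(S_p) and C^T = (+)_p C^(T_p). *)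
Definition structure : set 'M[R[i]]_(#|S|, #|T|) :=
  [set \sum_(p in components e)
         incl R (sources p) *m W p *m (incl R (ranges p))^T
  | W in [set: forall p, 'M[R[i]]_(#|sources p|, #|ranges p|)]].

Definition enhanced_structure :
    set 'M[R[i]]_(#|S| * #|S|, #|S| * #|T|) :=
  [set \sum_(p in components e)
         ((1%:M : 'M_#|S|) *t incl R (sources p)) *m W p
         *m ((1%:M : 'M_#|S|) *t incl R (ranges p))^T
  | W in [set: forall p,
           'M[R[i]]_(#|S| * #|sources p|, #|S| * #|ranges p|)]].

End GraphStructures.

(* Main.v *)
(* A vector of C^S (x) C^S is an n x n matrix U, n = #|S|, on which 1 (x) M acts
   by left multiplication.  A block-diagonal W of norm at most 1/b with
   W (1 (x) M) U = U exists iff b |U_p| <= |(M U)_p| (Frobenius norms) for every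
   component p.  The forms |(M U)_p|^2 - b^2 |U_p|^2 depend only on the Gram
   matrix U U^*, and U having n columns, every positive semidefinite matrix is
   such a Gram matrix; hence the joint range of these forms is a convex cone.
   If b > mu, this cone meets the nonnegative orthant at U = 0 only, so that
   separation yields weights d_p > 0 with
   sum_p d_p |(M U)_p|^2 <= b^2 sum_p d_p |U_p|^2.
   Then X = (+)_p sqrt(d_p), Y = (+)_p sqrt(d_p) satisfy |X M Y^-1| <= b.
   The other inequality holds because 1 (x) X and 1 (x) Y commute with the
   enhanced structure. *)

Require Import Defs.
From mathcomp Require Import all_boot all_order all_algebra.
From mathcomp Require Import complex mxtens.
From mathcomp Require Import boolp classical_sets reals.
From mathcomp Require Import topology normedtype derive ring lra.

Set Implicit Arguments.
Unset Strict Implicit.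
Unset Printing Implicit Defensive.

Import Order.TTheory GRing.Theory Num.Theory.
Import numFieldNormedType.Exports.

Local Open Scope ring_scope.
Local Open Scope complex_scope.
Local Open Scope sesquilinear_scope.

(** * Separation for convex cones of quadratic forms *)

(** The goal is linear in [t]: a point with [f u <= 0 < g u] demands [t >= g u / (g u - f u)], one
    with [g u <= 0 < f u] demands [t <= - g u / (f u - g u)]. The supremum of the lower bounds
    works, since two conflicting bounds would combine into a point where both forms are positive. *)
Lemma cone_merge (R : realType) (V : Type) (f g : V -> R)
    (cone : forall a b u w, 0 < a -> 0 < b ->
      exists v, f v = a * f u + b * f w /\ g v = a * g u + b * g w)
    (neg : forall u, f u <= 0 \/ g u <= 0) :
  exists t, [/\ 0 <= t, t <= 1 & forall u, t * f u + (1 - t) * g u <= 0].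
Proof.
pose A := [set s : R | s = 0 \/ exists u,
  [/\ f u <= 0, 0 < g u & s = g u / (g u - f u)]]%classic.
have A0 : A 0 by left.
(* Used with [c = 1] and with [c] an upper bound coming from a point where [f] is positive. *)
have leA c : (forall u, f u <= 0 -> 0 < g u -> g u <= c * (g u - f u)) ->
    0 <= c -> (forall s, A s -> s <= c).
  move=> h c0 s [->//|[u [fu gu ->]]].
  have p : 0 < g u - f u by lra.
  by rewrite ler_pdivrMr// h.
have A1 : ubound A 1 by apply: leA => // u fu gu; lra.
have supA : has_ubound A by exists 1.
exists (sup A); split.
- exact: (ub_le_sup supA A0).
- by apply: ge_sup => //; exists 0.
move=> u.
have s0 : 0 <= sup A by exact: (ub_le_sup supA A0).
have s1 : sup A <= 1 by apply: ge_sup => //; exists 0.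
have [gu|gu] := ltP 0 (g u).
  have fu : f u <= 0 by case: (neg u) => //; lra.
  have p : 0 < g u - f u by lra.
  have : g u / (g u - f u) <= sup A.
    by apply: (ub_le_sup supA); right; exists u.
  by rewrite ler_pdivrMr//; lra.
have [fu|fu] := leP (f u) 0; first by nra.
have p : 0 < f u - g u by lra.
suff : sup A <= - g u / (f u - g u) by rewrite ler_pdivlMr//; lra.
apply: ge_sup; first by exists 0.
apply: leA; last by apply: divr_ge0; lra.
move=> w fw gw; rewrite mulrAC ler_pdivlMr//.
rewrite leNgt; apply/negP => lt_w.
have q : 0 < g w - f w by lra.
(* These coefficients make the two forms equal at [v]: both are [f u * g w - g u * f w], which
   [lt_w] makes positive. *)
have [v [fv gv]] := cone _ _ u w q p.
by case: (neg v); rewrite ?fv ?gv; nra.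
Qed.

(* Gordan's alternative for a convex cone in R^(k+1), by merging the last two
   coordinates into a suitable convex combination. *)
Lemma cone_gordan (R : realType) (V : Type) (k : nat) (f : nat -> V -> R)
    (cone : forall a b u w, 0 < a -> 0 < b ->
      exists v, forall i, (i <= k)%N -> f i v = a * f i u + b * f i w)
    (neg : forall u, exists2 i, (i <= k)%N & f i u <= 0) :
  exists d : nat -> R, [/\ forall i, 0 <= d i, \sum_(i < k.+1) d i = 1
    & forall u, \sum_(i < k.+1) d i * f i u <= 0].
Proof.
elim: k f cone neg => [|k IH] f cone neg.
  exists (fun=> 1); split; [by [] | by rewrite big_ord1 | move=> u].
  have [j] := neg u; rewrite leqn0 => /eqP -> fu.
  by rewrite big_ord1 mul1r.
(* On this subcone the first [k] forms are positive, so [neg] leaves one of the last two nonpositive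
   and [cone_merge] applies. *)
pose C0 := {u | forall i, (i < k)%N -> 0 < f i u}.
have [||t [t0 t1 ft]] := @cone_merge R C0 (fun u => f k (sval u))
    (fun u => f k.+1 (sval u)).
- move=> a b [u pu] [w pw] a0 b0; have [v fv] := cone a b u w a0 b0.
  have pv i : (i < k)%N -> 0 < f i v.
    move=> ik; rewrite fv; last by rewrite ltnW// ltnS ltnW.
    by rewrite addr_gt0// mulr_gt0// ?pu ?pw.
  by exists (exist _ v pv); rewrite /= !fv.
- move=> [u pu] /=; have [j] := neg u.
  rewrite leq_eqVlt ltnS => /orP[/eqP ->|]; first by right.
  rewrite leq_eqVlt => /orP[/eqP ->|/pu]; first by left.
  by move=> /lt_le_trans h /h; rewrite ltxx.
pose g i u := if i == k then t * f k u + (1 - t) * f k.+1 u else f i u.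
have [||d [d0 d1 dg]] := IH g.
- move=> a b u w a0 b0; have [v fv] := cone a b u w a0 b0.
  exists v => i ik; rewrite /g; case: eqP => _; rewrite !fv //; first by ring.
  exact: leqW.
- move=> u; have [[i ik fi]|pu] := pselect (exists2 i, (i < k)%N & f i u <= 0).
    by exists i; rewrite /g ?(ltn_eqF ik)// ltnW.
  have pu' i : (i < k)%N -> 0 < f i u.
    by move=> ik; rewrite ltNge; apply/negP => fi; apply: pu; exists i.
  by exists k; rewrite // /g eqxx; apply: (ft (exist _ u pu')).
(* The weight of the merged form is split in the ratio [t] to [1 - t] between the two forms it was
   made of. *)
exists (fun i => if i == k.+1 then d k * (1 - t) else
                 if i == k then d k * t else d i); split.
- move=> i; have := d0 k; have := d0 i.
  by do 2?case: ifP => _ //; move=> *; rewrite mulr_ge0// subr_ge0.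
- rewrite !big_ord_recr /= !eqxx (ltn_eqF (ltnSn k)) -[RHS]d1 big_ord_recr /=.
  rewrite -addrA; congr (_ + _); last by ring.
  by apply: eq_bigr => i _; rewrite !ltn_eqF// ltnS ltnW.
move=> u; rewrite !big_ord_recr /= !eqxx (ltn_eqF (ltnSn k)).
have := dg u; rewrite big_ord_recr /= {2}/g eqxx; congr (_ <= _).
rewrite -addrA; congr (_ + _); last by ring.
by apply: eq_bigr => i _; rewrite /g !ltn_eqF// ltnS ltnW.
Qed.

Lemma continuous_sum (R : realType) (T : topologicalType) (I : finType)
    (A : {set I}) (f : I -> T -> R) :
  (forall p, p \in A -> continuous (f p)) ->
  continuous (fun u => \sum_(p in A) f p u).
Proof.
by move=> fc u; apply: cvg_big => [|p pA]; [exact: add_continuous | exact: fc].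
Qed.

(* Compactness of the unit sphere makes the hypothesis [neg] uniform,
   [min_p q p u <= - eps * N u]; Gordan's alternative for the forms
   [q p + eps * N] then leaves room to make all the weights positive. *)
Lemma s_procedure (R : realType) (D : nat) (P : finType) (A : {set P})
    (q : P -> 'rV[R]_D -> R) (N : 'rV[R]_D -> R)
    (qcont : forall p, p \in A -> continuous (q p)) (Ncont : continuous N)
    (q2 : forall p, p \in A -> forall c u, q p (c *: u) = c ^+ 2 * q p u)
    (N2 : forall c u, N (c *: u) = c ^+ 2 * N u)
    (N0 : forall u, u != 0 -> 0 < N u)
    (qD : forall u w, exists v, N v = N u + N w /\
      forall p, p \in A -> q p v = q p u + q p w)
    (neg : forall u, u != 0 -> exists2 p, p \in A & q p u < 0) :
  exists d : P -> R, (forall p, 0 < d p) /\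
    forall u, \sum_(p in A) d p * q p u <= 0.
Proof.
have [A0|[p0 Ap0]] := set_0Vmem A.
  by exists (fun=> 1); split => // u; rewrite A0 big_set0.
have q0 p : p \in A -> q p 0 = 0.
  by move=> Ap; rewrite -(scale0r 0) q2// expr0n mul0r.
have Nz : N 0 = 0 by rewrite -(scale0r 0) N2 expr0n mul0r.
pose K := [set u : 'rV[R]_D | `|u| = 1]%classic.
have normal u : u != 0 -> K (`|u|^-1 *: u).
  by move=> u0; rewrite /K /= normrZ normfV normr_id mulVf ?normr_eq0.
(* An empty sphere means that 0 is the only vector; any weights then do. *)
have [[u0 Ku0]|K0] := pselect (K !=set0)%classic; last first.
  exists (fun=> 1); split => // u; rewrite big1// => p Ap.
  have [->|/normal Ku] := eqVneq u 0; first by rewrite q0// mulr0.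
  by case: K0; exists (`|u|^-1 *: u).
have Kcpt : compact K.
  apply: bounded_closed_compact.
    by exists 1; split => // x x1 u /= ->; exact: ltW.
  by apply: (@preimage_closed _ _ (fun u : 'rV[R]_D => `|u|)
    [set x | x = 1]%classic) => [u _|]; [exact: norm_continuous | exact: closed_eq].
have Kn u : K u -> u != 0.
  move=> Ku; apply/eqP => u_0; move: Ku.
  by rewrite /K /= u_0 normr0 => /eqP; rewrite eq_sym oner_eq0.
have Kmax (f : 'rV[R]_D -> R) : continuous f ->
    exists b, forall u, K u -> f u <= b.
  move=> fc; have [||b _ fb] := @compact_EVT_max _ R f K _ Kcpt.
  - by exists u0.
  - exact: continuous_subspaceT.
  by exists (f b) => u Ku; apply: fb; rewrite inE.
have Kmin (f : 'rV[R]_D -> R) : continuous f -> (forall u, K u -> 0 < f u) ->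
    exists2 b, 0 < b & forall u, K u -> b <= f u.
  move=> fc f0; have [||b Kb fb] := @compact_EVT_min _ R f K _ Kcpt.
  - by exists u0.
  - exact: continuous_subspaceT.
  by exists (f b) => [|u Ku];
    [apply: f0; rewrite inE in Kb | apply: fb; rewrite inE].
have qn p : p \in A -> continuous (fun u => `|q p u|).
  by move=> Ap u; apply: continuous_comp; [exact: qcont | exact: norm_continuous].
(* The sum is twice the total negative part of the forms, which [neg] makes positive on the
   sphere. *)
have [c c0 hc] : exists2 c, 0 < c &
    forall u, K u -> c <= \sum_(p in A) (`|q p u| - q p u).
  apply: Kmin => [|u /Kn/neg[p Ap qp]].
    apply: continuous_sum => p Ap u; exact: (continuousB (qn p Ap u) (qcont p Ap u)).
  rewrite (bigD1 p)//= ltr_pwDl//; first by rewrite ltr0_norm//; lra.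
  by apply: sumr_ge0 => i _; rewrite subr_ge0 ler_norm.
have [m m0 hm] := Kmin N Ncont (fun u Ku => N0 u (Kn u Ku)).
have [B hB] := Kmax N Ncont.
have [B' hB'] : exists b, forall u, K u -> \sum_(p in A) `|q p u| <= b.
  by apply: Kmax; exact: continuous_sum.
have cardA : 0 < #|A|%:R :> R by rewrite ltr0n; apply/card_gt0P; exists p0.
have B0 : 0 < B by apply: lt_le_trans (hB _ Ku0); apply: lt_le_trans (hm _ Ku0).
(* If every [q p + eps * N] were positive at a unit vector, each [|q p| - q p] would be below
   [2 * eps * B]; summing over [A] would give less than [c], against [hc]. *)
pose eps := c / (2 * #|A|%:R * B).
have eps0 : 0 < eps by rewrite divr_gt0// !mulr_gt0.
have scale u : u != 0 -> [/\ K (`|u|^-1 *: u), 0 < `|u| ^+ 2,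
    N u = `|u| ^+ 2 * N (`|u|^-1 *: u) &
    forall p, p \in A -> q p u = `|u| ^+ 2 * q p (`|u|^-1 *: u)].
  move=> un0; have u1 : u = `|u| *: (`|u|^-1 *: u).
    by rewrite scalerA divff ?normr_eq0// scale1r.
  split; [exact: normal | by rewrite exprn_gt0 ?normr_gt0 | by rewrite -N2 -u1|].
  by move=> p Ap; rewrite -q2// -u1.
pose s := enum A.
pose f (i : nat) u := q (nth p0 s i) u + eps * N u.
have szA : size s = #|A| by rewrite -cardE.
have nthA i : (i <= #|A|.-1)%N -> nth p0 s i \in A.
  move=> ik; rewrite -mem_enum mem_nth// szA.
  by rewrite (leq_ltn_trans ik)// ltn_predL; apply/card_gt0P; exists p0.
have [||d [d0 d1 df]] := @cone_gordan R _ #|A|.-1 f.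
- move=> a b u w a0 b0.
  (* The forms are quadratic, so scaling vectors by square roots scales the forms by [a] and [b]. *)
  have [v [Nv qv]] := qD (Num.sqrt a *: u) (Num.sqrt b *: w).
  exists v => i ik; rewrite /f qv ?nthA// Nv !N2 !q2 ?nthA// !sqr_sqrtr ?ltW//.
  by ring.
- move=> u; have [->|un0] := eqVneq u 0.
    by exists 0; rewrite // /f q0 ?nthA// Nz mulr0 addr0.
  have [Kv v0 Nv qv] := scale u un0.
  have [p Ap] : exists2 p, p \in A & q p u + eps * N u <= 0; last first.
    move=> le0; exists (index p s); rewrite /f ?nth_index ?mem_enum//.
    by rewrite -ltnS prednK -?szA ?index_mem ?mem_enum// szA;
      apply/card_gt0P; exists p0.
  apply: contrapT => no.
  have pos p : p \in A -> 0 < q p (`|u|^-1 *: u) + eps * N (`|u|^-1 *: u).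
    move=> Ap; rewrite ltNge; apply/negP => le0; apply: no; exists p => //.
    by rewrite qv// Nv mulrCA -mulrDr pmulr_rle0.
  have : \sum_(p in A) (`|q p (`|u|^-1 *: u)| - q p (`|u|^-1 *: u))
       < \sum_(p in A) (2 * (eps * B)).
    apply: ltr_sum; first by apply/hasP; exists p0; rewrite ?mem_index_enum.
    move=> p Ap; have := pos p Ap.
    have : eps * N (`|u|^-1 *: u) <= eps * B by rewrite ler_pM2l// hB.
    have : 0 < eps * B by rewrite mulr_gt0.
    have [q_ge|q_lt] := leP 0 (q p (`|u|^-1 *: u)).
      by rewrite ger0_norm//; lra.
    by rewrite ltr0_norm//; lra.
  rewrite sumr_const => /(le_lt_trans (hc _ Kv)).
  suff -> : 2 * (eps * B) *+ #|A| = c by rewrite ltxx.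
  by rewrite -[LHS]mulr_natr /eps; field; rewrite !gt_eqF.
(* Adding [del] to every weight costs at most [del * B' <= eps * m] on the sphere, which the slack
   [eps * N] absorbs; the [+ 1] keeps the denominator positive. *)
pose del := eps * m / (B' + 1).
have B'0 : 0 <= B' by apply: le_trans (hB' _ Ku0); exact: sumr_ge0.
have del0 : 0 < del by apply: divr_gt0; [exact: mulr_gt0 | lra].
exists (fun p => d (index p s) + del); split=> [p|u].
  by have := d0 (index p s); lra.
have [->|un0] := eqVneq u 0.
  by rewrite big1// => p Ap; rewrite q0// mulr0.
have sumA (F : nat -> P -> R) : \sum_(p in A) F (index p s) p =
    \sum_(i < #|A|.-1.+1) F i (nth p0 s i).
  rewrite -big_enum (big_nth p0) szA big_mkord prednK; last by rewrite -(ltr0n R).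
  by apply: eq_bigr => i _; rewrite index_uniq ?enum_uniq// szA.
have [Kv v0 Nv qv] := scale u un0.
have le1 : \sum_(p in A) d (index p s) * q p u <= - (eps * N u).
  rewrite (sumA (fun i p => d i * q p u)) -subr_le0 opprK.
  apply: le_trans (df u); rewrite le_eqVlt; apply/orP; left; apply/eqP.
  rewrite -[X in _ + X = _]mul1r -d1 mulr_suml -big_split /=.
  by apply: eq_bigr => i _; rewrite /f mulrDr.
have le2 : \sum_(p in A) del * q p u <= eps * N u.
  apply: (@le_trans _ _ (`|u| ^+ 2 * (del * B'))).
    rewrite -mulr_sumr mulrCA ler_pM2l//.
    apply: le_trans (_ : `|u| ^+ 2 * \sum_(p in A) `|q p (`|u|^-1 *: u)| <= _).
      by rewrite mulr_sumr; apply: ler_sum => p Ap; rewrite qv// ler_pM2l// ler_norm.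
    by rewrite ler_pM2l// hB'.
  rewrite Nv [leRHS]mulrCA ler_pM2l// (@le_trans _ _ (eps * m))//; last first.
    by rewrite ler_pM2l// hm.
  rewrite /del mulrAC ler_pdivrMr; last by lra.
  by rewrite mulrDr mulr1 lerDl ltW// mulr_gt0.
by under eq_bigr do rewrite mulrDl; rewrite big_split /=; lra.
Qed.

(** * Frobenius and operator norms *)

Section Frobenius.
Variable R : realType.
Local Notation C := R[i].

(** The squared Frobenius norm, kept in [R] by taking real parts of the complex-valued norm. Columns
    are summed outermost, so that on a column vector it reduces to the sum in [l2norm]. *)
Definition fro2 m n (A : 'M[C]_(m, n)) : R :=
  \sum_j \sum_i (complex.Re `|A i j|) ^+ 2.

Lemma sqr_Re_norm (z : C) :
  (complex.Re `|z|) ^+ 2 = complex.Re z ^+ 2 + complex.Im z ^+ 2.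
Proof. by rewrite normc_def /= sqr_sqrtr// addr_ge0// sqr_ge0. Qed.

Lemma ReE_norm (z : C) : (complex.Re `|z|)%:C = `|z|.
Proof. by rewrite normc_def. Qed.

Lemma Re_norm_ge0 (z : C) : 0 <= complex.Re `|z|.
Proof. by rewrite normc_def /= sqrtr_ge0. Qed.

Lemma l2norm_fro2 n (v : 'cV[C]_n) : l2norm v = Num.sqrt (fro2 v).
Proof. by rewrite /fro2 big_ord1. Qed.

Lemma fro2_trace m n (A : 'M[C]_(m, n)) : (fro2 A)%:C = \tr (A *m A ^t*).
Proof.
rewrite rmorph_sum /= /mxtrace.
under [RHS]eq_bigr do rewrite mxE; rewrite exchange_big; apply: eq_bigr => i _.
rewrite rmorph_sum /=; apply: eq_bigr => j _.
by rewrite rmorphXn /= ReE_norm normCK !mxE.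
Qed.

Lemma fro2_ge0 m n (A : 'M[C]_(m, n)) : 0 <= fro2 A.
Proof. by apply: sumr_ge0 => i _; apply: sumr_ge0 => j _; rewrite sqr_ge0. Qed.

Lemma fro2_0 m n : fro2 (0 : 'M[C]_(m, n)) = 0.
Proof. by apply: complexI; rewrite fro2_trace mul0mx mxtrace0. Qed.

Lemma fro2_eq0 m n (A : 'M[C]_(m, n)) : (fro2 A == 0) = (A == 0).
Proof.
apply/eqP/eqP => [|->]; last exact: fro2_0.
move=> /eqP; rewrite psumr_eq0; last first.
  by move=> j _; apply: sumr_ge0 => i _; rewrite sqr_ge0.
move=> /allP Aj; apply/matrixP => i j; rewrite mxE.
have := Aj j; rewrite mem_index_enum => /(_ isT); rewrite psumr_eq0; last first.
  by move=> k _; rewrite sqr_ge0.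
move=> /allP/(_ i); rewrite mem_index_enum => /(_ isT).
rewrite implyTb sqrf_eq0 => /eqP Re0.
by apply/eqP; rewrite -normr_eq0 -ReE_norm Re0.
Qed.

Lemma fro2_gt0 m n (A : 'M[C]_(m, n)) : (0 < fro2 A) = (A != 0).
Proof. by rewrite lt_def fro2_ge0 fro2_eq0 andbT. Qed.

Lemma adjmxM m n p (A : 'M[C]_(m, n)) (B : 'M[C]_(n, p)) :
  (A *m B) ^t* = B ^t* *m A ^t*.
Proof. by rewrite trmx_mul map_mxM. Qed.

Lemma fro2_adj m n (A : 'M[C]_(m, n)) : fro2 (A ^t*) = fro2 A.
Proof. by apply: complexI; rewrite !fro2_trace trmxCK mxtrace_mulC. Qed.

Lemma fro2Z m n (c : C) (A : 'M[C]_(m, n)) :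
  fro2 (c *: A) = complex.Re `|c| ^+ 2 * fro2 A.
Proof.
rewrite /fro2 mulr_sumr; apply: eq_bigr => j _; rewrite mulr_sumr.
apply: eq_bigr => i _; rewrite -exprMn mxE; congr (_ ^+ 2).
by apply: complexI; rewrite rmorphM /= !ReE_norm normrM.
Qed.

Lemma fro2ZR m n (c : R) (A : 'M[C]_(m, n)) :
  fro2 (c%:C *: A) = c ^+ 2 * fro2 A.
Proof. by rewrite fro2Z sqr_Re_norm /= expr0n addr0. Qed.

Lemma fro2_col m n (A : 'M[C]_(m, n)) : fro2 A = \sum_j fro2 (col j A).
Proof.
apply: eq_bigr => j _; rewrite /fro2 big_ord1.
by apply: eq_bigr => i _; rewrite mxE.
Qed.

Lemma fro2_bound_col m n k (A : 'M[C]_(m, n)) (c : R) (U : 'M[C]_(n, k)) :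
  (forall v : 'cV_n, fro2 (A *m v) <= c * fro2 v) -> fro2 (A *m U) <= c * fro2 U.
Proof.
move=> Ac; rewrite !fro2_col mulr_sumr; apply: ler_sum => j _.
by rewrite colE -mulmxA -colE.
Qed.

(** With [X], [Y], [P] the three sums, the nonnegative sum of the [(x k * Y - y k * P) ^+ 2] equals
    [Y * (X * Y - P ^+ 2)]; if [Y = 0], all [y k] vanish. *)
Lemma sum_cauchy_schwarz n (x y : 'I_n -> R) :
  (\sum_k x k * y k) ^+ 2 <= (\sum_k x k ^+ 2) * (\sum_k y k ^+ 2).
Proof.
set X := \sum_k x k ^+ 2; set Y := \sum_k y k ^+ 2; set P := \sum_k _.
have Y0 : 0 <= Y by apply: sumr_ge0 => k _; rewrite sqr_ge0.
have : 0 <= \sum_k (x k * Y - y k * P) ^+ 2.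
  by apply: sumr_ge0 => k _; rewrite sqr_ge0.
have -> : \sum_k (x k * Y - y k * P) ^+ 2 = Y * (X * Y - P ^+ 2).
  transitivity (\sum_k (Y ^+ 2 * x k ^+ 2 + - (2 * P * Y) * (x k * y k)
                + P ^+ 2 * y k ^+ 2)); first by apply: eq_bigr => k _; ring.
  by rewrite !big_split /= -!mulr_sumr -/X -/Y -/P; ring.
have [Y_gt|Y_le] := ltP 0 Y; first by rewrite pmulr_rge0// subr_ge0.
have {}Y0 : Y = 0 by apply/eqP; rewrite eq_le Y_le.
move=> _; suff -> : P = 0 by rewrite Y0 mulr0 expr0n.
apply: big1 => k _; have /eqP := Y0.
rewrite psumr_eq0 => [/allP/(_ k)|j _]; last exact: sqr_ge0.
by rewrite mem_index_enum implyTb sqrf_eq0 => /(_ isT)/eqP ->; rewrite mulr0.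
Qed.

Lemma fro2M m n p (A : 'M[C]_(m, n)) (B : 'M[C]_(n, p)) :
  fro2 (A *m B) <= fro2 A * fro2 B.
Proof.
rewrite [leRHS]mulrC mulr_suml; apply: ler_sum => j _.
rewrite [fro2 A]exchange_big mulr_sumr; apply: ler_sum => i _; rewrite mulrC.
apply: le_trans (sum_cauchy_schwarz _ _).
rewrite ler_sqr ?nnegrE; last 2 first.
- by rewrite Re_norm_ge0.
- by apply: sumr_ge0 => k _; rewrite mulr_ge0 ?Re_norm_ge0.
rewrite -lecR ReE_norm rmorph_sum mxE (le_trans (ler_norm_sum _ _ _))//.
by apply: ler_sum => k _; rewrite rmorphM /= !ReE_norm normrM.
Qed.

(** A supremum says something about its set only if that set is bounded; submultiplicativity of the
    Frobenius norm provides the bound. *)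
Lemma opnorm_has_ubound m n (A : 'M[C]_(m, n)) :
  has_ubound [set l2norm (A *m v) | v in [set v : 'cV_n | l2norm v <= 1]]%classic.
Proof.
exists (Num.sqrt (fro2 A)) => _ [v /= v1 <-]; move: v1.
rewrite !l2norm_fro2 -{1}sqrtr1 !ler_sqrt ?fro2_ge0// => v1.
by rewrite (le_trans (fro2M _ _))// ler_piMr ?fro2_ge0.
Qed.

Lemma opnorm_ge0 m n (A : 'M[C]_(m, n)) : 0 <= opnorm A.
Proof.
apply: (ub_le_sup (opnorm_has_ubound A)); exists 0.
  by rewrite /= l2norm_fro2 fro2_0 sqrtr0.
by rewrite mulmx0 l2norm_fro2 fro2_0 sqrtr0.
Qed.

(** Columns can be treated one at a time, and a nonzero column is rescaled to unit norm, where the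
    definition of [opnorm] applies. *)
Lemma fro2_opnorm m n k (A : 'M[C]_(m, n)) (U : 'M[C]_(n, k)) :
  fro2 (A *m U) <= opnorm A ^+ 2 * fro2 U.
Proof.
apply: fro2_bound_col => v.
have [->|v0] := eqVneq v 0; first by rewrite mulmx0 !fro2_0 mulr0.
have fv : 0 < fro2 v by rewrite fro2_gt0.
pose c := (Num.sqrt (fro2 v))^-1.
have c0 : 0 < c by rewrite invr_gt0 sqrtr_gt0.
have c2 : c ^+ 2 = (fro2 v)^-1 by rewrite exprVn sqr_sqrtr ?fro2_ge0.
have : l2norm (A *m (c%:C *: v)) <= opnorm A.
  apply: (ub_le_sup (opnorm_has_ubound A)); exists (c%:C *: v) => //=.
  by rewrite l2norm_fro2 fro2ZR c2 mulVf ?gt_eqF// sqrtr1.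
rewrite l2norm_fro2 -scalemxAr fro2ZR c2.
rewrite -[leLHS]ger0_norm ?sqrtr_ge0// -ler_sqr ?nnegrE ?opnorm_ge0//.
rewrite real_normK ?num_real// sqr_sqrtr; last by rewrite mulr_ge0 ?invr_ge0 ?fro2_ge0.
by rewrite mulrC ler_pdivrMr.
Qed.

Lemma opnorm_le m n (A : 'M[C]_(m, n)) (c : R) : 0 <= c ->
  (forall v : 'cV_n, fro2 (A *m v) <= c ^+ 2 * fro2 v) -> opnorm A <= c.
Proof.
move=> c0 Ac; apply: ge_sup.
  by exists (l2norm (A *m 0)); exists 0 => //=; rewrite l2norm_fro2 fro2_0 sqrtr0.
move=> _ [v /= v1 <-]; move: v1; rewrite !l2norm_fro2 -{1}sqrtr1 ler_sqrt// => v1.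
rewrite -[c]ger0_norm// -sqrtr_sqr ler_sqrt ?sqr_ge0//.
by rewrite (le_trans (Ac v))// ler_piMr ?sqr_ge0.
Qed.

(* Gram-Schmidt on the rows of [U W] gives [U W] = V Q with Q Q^* = 1. *)
Lemma exists_gram_add n (U W : 'M[C]_n) :
  exists V : 'M[C]_n, V *m V ^t* = U *m U ^t* + W *m W ^t*.
Proof.
pose Q := schmidt (row_mx U W).
have /submxP[V UW] := schmidt_sub (row_mx U W).
have QQ : Q *m Q ^t* = 1%:M by apply/unitarymxP/schmidt_unitarymx/leq_addr.
exists V; transitivity (row_mx U W *m (row_mx U W) ^t*); last first.
  by rewrite tr_row_mx map_col_mx mul_row_col.
by rewrite UW adjmxM mulmxA -(mulmxA V) QQ mulmx1.
Qed.

(** The squared norm of [K *m U] is the trace of [K U U^* K^*], hence additive in the Gram matrix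
    [U U^*]. *)
Lemma fro2_gram_add n p (V U W : 'M[C]_n) (K : 'M[C]_(p, n)) :
  V *m V ^t* = U *m U ^t* + W *m W ^t* ->
  fro2 (K *m V) = fro2 (K *m U) + fro2 (K *m W).
Proof.
move=> VUW; apply: complexI; rewrite rmorphD /= !fro2_trace !adjmxM.
by rewrite !mulmxA -!(mulmxA K) VUW mulmxDl mulmxDr mxtraceD.
Qed.

End Frobenius.

(** * Tensor products as spaces of matrices *)

Section Vectorization.
Variable R : realType.
Local Notation C := R[i].

(* C^k (x) C^m as m x k matrices, so that 1 (x) A acts by left multiplication. *)
Definition unvec k m (u : 'cV[C]_(k * m)) : 'M[C]_(m, k) :=
  \matrix_(j, i) u (mxtens_index (i, j)) 0.

Definition vec k m (U : 'M[C]_(m, k)) : 'cV[C]_(k * m) :=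
  \col_l U (mxtens_unindex l).2 (mxtens_unindex l).1.

Lemma vecK k m : cancel (@vec k m) (@unvec k m).
Proof. by move=> U; apply/matrixP => i j; rewrite !mxE mxtens_indexK. Qed.

Lemma unvecK k m : cancel (@unvec k m) (@vec k m).
Proof.
by move=> u; apply/colP => l; rewrite !mxE -surjective_pairing mxtens_unindexK.
Qed.

Lemma sum_tens (V : nmodType) k m (F : 'I_(k * m) -> V) :
  \sum_l F l = \sum_i \sum_j F (mxtens_index (i, j)).
Proof.
rewrite pair_big; rewrite (reindex (@mxtens_index k m)) /=.
  by apply: eq_bigr => -[].
by exists (@mxtens_unindex k m) => ? _; rewrite ?mxtens_indexK ?mxtens_unindexK.
Qed.

Lemma unvec_tens k m n (A : 'M[C]_(m, n)) (u : 'cV[C]_(k * n)) :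
  unvec (((1%:M : 'M_k) *t A) *m u) = A *m unvec u.
Proof.
apply/matrixP => j i; rewrite !mxE sum_tens (bigD1 i)//= [X in _ + X]big1 => [|l li].
  rewrite addr0; apply: eq_bigr => r _.
  by rewrite tensmxE !mxE eqxx mul1r.
by apply: big1 => r _; rewrite tensmxE mxE eq_sym (negPf li) !mul0r.
Qed.

Lemma fro2_unvec k m (u : 'cV[C]_(k * m)) : fro2 (unvec u) = fro2 u.
Proof.
rewrite {2}/fro2 big_ord1 sum_tens; apply: eq_bigr => i _.
by apply: eq_bigr => j _; rewrite mxE.
Qed.

(** Splits an operator on the tensor product into elementary tensors, so that commutation can be
    checked block by block. *)
Lemma tens_blocks k m n (A : 'M[C]_(k * m, k * n)) :
  A = \sum_i \sum_j delta_mx i j *t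
        (\matrix_(a, b) A (mxtens_index (i, a)) (mxtens_index (j, b))).
Proof.
apply/matrixP => x y; case: (mxtens_indexP x) => i a; case: (mxtens_indexP y) => j b.
rewrite summxE (bigD1 i)//= [X in _ + X]big1 => [|i' ii].
  rewrite addr0 summxE (bigD1 j)//= [X in _ + X]big1 => [|j' jj].
    by rewrite addr0 tensmxE !mxE !eqxx mul1r.
  by rewrite tensmxE !mxE eqxx eq_sym (negPf jj) mul0r.
rewrite summxE big1// => j' _.
by rewrite tensmxE !mxE eq_sym (negPf ii) mul0r.
Qed.

End Vectorization.

(** * Real coordinates and continuity of the quadratic forms *)

Section RealCoordinates.
Variable R : realType.
Local Notation C := R[i].

(** Real and imaginary parts are laid side by side in one real row, the domain required by
    [s_procedure]. *)
Definition cmx n (x : 'rV[R]_(n * n + n * n)) : 'M[C]_n :=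
  \matrix_(i, j) Complex (x 0 (lshift _ (mxvec_index i j)))
                         (x 0 (rshift _ (mxvec_index i j))).

Definition rcoord n (U : 'M[C]_n) : 'rV[R]_(n * n + n * n) :=
  row_mx (mxvec (map_mx (@complex.Re R) U)) (mxvec (map_mx (@complex.Im R) U)).

Lemma rcoordK n : cancel (@rcoord n) (@cmx n).
Proof.
move=> U; apply/matrixP => i j.
by rewrite [LHS]mxE row_mxEl row_mxEr !mxvecE !mxE; case: (U i j).
Qed.

Lemma cmx_linear n (a : R) (x y : 'rV_(n * n + n * n)) :
  cmx (a *: x + y) = a%:C *: cmx x + cmx y.
Proof.
apply/matrixP => i j; rewrite !mxE; apply/eqP.
by rewrite eq_complex /= !mul0r subr0 addr0 !eqxx.
Qed.

Lemma cmx_scale n (a : R) (x : 'rV_(n * n + n * n)) :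
  cmx (a *: x) = a%:C *: cmx x.
Proof.
apply/matrixP => i j; rewrite !mxE; apply/eqP.
by rewrite eq_complex /= !mul0r subr0 addr0 !eqxx.
Qed.

Lemma cmx_eq0 n (x : 'rV_(n * n + n * n)) : cmx x = 0 -> x = 0.
Proof.
move=> /matrixP x0; apply/rowP => k; rewrite mxE.
by rewrite -[k]splitK; case: (split k) => l /=; case/mxvec_indexP: l => i j;
  have := x0 i j; rewrite !mxE => -[].
Qed.

Lemma linear_continuous_rV D (f : 'rV[R]_D -> R) :
  (forall a x y, f (a *: x + y) = a * f x + f y) -> continuous f.
Proof.
move=> fL.
have f0 : f 0 = 0.
  by have := fL (-1) 0 0; rewrite scaler0 add0r mulN1r addNr.
have -> : f = fun x => \sum_(j in [set: 'I_D]%SET) x 0 j * f (delta_mx 0 j).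
  apply: funext => x; rewrite {1}[x]row_sum_delta.
  under [RHS]eq_bigl do rewrite inE.
  by elim/big_rec2: _ => // j y1 y2 _ <-.
apply: continuous_sum => j _ x.
apply: (@continuousM _ _ (fun y : 'rV[R]_D => y 0 j) (fun=> f (delta_mx 0 j))).
  exact: coord_continuous.
exact: cst_continuous.
Qed.

Lemma fro2_cmx_continuous n p (K : 'M[C]_(p, n)) :
  continuous (fun x : 'rV[R]_(n * n + n * n) => fro2 (K *m cmx x)).
Proof.
have lin (a : R) (x y : 'rV[R]_(n * n + n * n)) i j :
    (K *m cmx (a *: x + y)) i j = a%:C * (K *m cmx x) i j + (K *m cmx y) i j.
  by rewrite cmx_linear mulmxDr -scalemxAr !mxE.
(* The squared norm becomes a sum of squares of real-linear functionals. *)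
have -> : (fun x : 'rV[R]_(n * n + n * n) => fro2 (K *m cmx x)) =
   fun x => \sum_(j in [set: 'I_n]%SET) \sum_(i in [set: 'I_p]%SET)
     (complex.Re ((K *m cmx x) i j) * complex.Re ((K *m cmx x) i j) +
      complex.Im ((K *m cmx x) i j) * complex.Im ((K *m cmx x) i j)).
  apply: funext => x; apply: eq_big => [j|j _]; first by rewrite inE.
  apply: eq_big => [i|i _]; first by rewrite inE.
  by rewrite sqr_Re_norm !expr2.
apply: continuous_sum => j _; apply: continuous_sum => i _ x.
have cRe : continuous (fun x : 'rV[R]_(n * n + n * n) =>
    complex.Re ((K *m cmx x) i j)).
  apply: linear_continuous_rV => a y z; rewrite lin.
  by case: (_ i j) => ? ?; case: (_ i j) => ? ? /=; rewrite mul0r subr0.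
have cIm : continuous (fun x : 'rV[R]_(n * n + n * n) =>
    complex.Im ((K *m cmx x) i j)).
  apply: linear_continuous_rV => a y z; rewrite lin.
  by case: (_ i j) => ? ?; case: (_ i j) => ? ? /=; rewrite mul0r addr0.
exact: (continuousD (continuousM (cRe x) (cRe x)) (continuousM (cIm x) (cIm x))).
Qed.

(** Applies [s_procedure] to the differences [|K p U|^2 - beta |J p U|^2] in real coordinates. The
    additivity it asks for comes from adding Gram matrices, which is possible because [U] is
    square. *)
Lemma gram_s_procedure n (P : finType) (A : {set P}) (a b : P -> nat)
    (K : forall p, 'M[C]_(a p, n)) (J : forall p, 'M[C]_(b p, n)) (beta : R)
    (neg : forall U : 'M[C]_n, U != 0 -> exists2 p, p \in A &
      fro2 (K p *m U) < beta * fro2 (J p *m U)) :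
  exists d : P -> R, (forall p, 0 < d p) /\ forall U : 'M[C]_n,
    \sum_(p in A) d p * fro2 (K p *m U)
      <= beta * \sum_(p in A) d p * fro2 (J p *m U).
Proof.
pose q p x := fro2 (K p *m cmx x) - beta * fro2 (J p *m cmx x).
have [|||||||d [d0 dq]] := @s_procedure R _ P A q (fun x => fro2 (cmx x)).
- move=> p _ x.
  apply: (continuousB (@fro2_cmx_continuous _ _ (K p) x)).
  apply: (@continuousM _ _ (fun=> beta)); first exact: cst_continuous.
  exact: fro2_cmx_continuous.
- have -> : (fun x : 'rV[R]_(n * n + n * n) => fro2 (cmx x)) =
      fun x => fro2 (1%:M *m cmx x).
    by apply: funext => x; rewrite mul1mx.
  exact: fro2_cmx_continuous.
- by move=> p _ c u; rewrite /q cmx_scale -!scalemxAr !fro2ZR; ring.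
- by move=> c u; rewrite cmx_scale fro2ZR.
- by move=> u u0; rewrite fro2_gt0; apply: contra u0 => /eqP/cmx_eq0 ->.
- move=> u w; have [V VV] := exists_gram_add (cmx u) (cmx w).
  exists (rcoord V); rewrite /q rcoordK; split.
    by have := fro2_gram_add 1%:M VV; rewrite !mul1mx.
  by move=> p _; rewrite !(fro2_gram_add _ VV); ring.
- move=> u u0; have [|p Ap qp] := neg (cmx u).
    by apply: contra u0 => /eqP/cmx_eq0 ->.
  by exists p; rewrite // /q subr_lt0.
exists d; split=> // U; have := dq (rcoord U); rewrite /q rcoordK.
under eq_bigr do rewrite mulrBr mulrCA.
by rewrite sumrB subr_le0 -mulr_sumr.
Qed.

End RealCoordinates.

(** * Block-diagonal operators *)

Section Resolution.
Variables (R : realType) (P : finType) (cs : {set P}).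
Local Notation C := R[i].

(* Real isometries [J p : C^(a p) -> C^N], [p \in cs], whose ranges form an
   orthogonal decomposition of C^N. *)
Definition resolution N (a : P -> nat) (J : forall p, 'M[C]_(N, a p)) : Prop :=
  [/\ forall p, p \in cs -> (J p)^T *m J p = 1%:M,
      forall p q, p \in cs -> q \in cs -> p != q -> (J p)^T *m J q = 0,
      \sum_(p in cs) J p *m (J p)^T = 1%:M &
      forall p, (J p) ^t* = (J p)^T].

Definition block_diag M N (a b : P -> nat) (J : forall p, 'M[C]_(M, a p))
    (K : forall p, 'M[C]_(N, b p)) (W : forall p, 'M[C]_(a p, b p)) :=
  \sum_(p in cs) J p *m W p *m (K p)^T.

Lemma resolution_ext N (a : P -> nat) (J : forall p, 'M[C]_(N, a p)) n
    (A B : 'M[C]_(N, n)) : resolution J ->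
  (forall p, p \in cs -> (J p)^T *m A = (J p)^T *m B) -> A = B.
Proof.
move=> [_ _ J1 _] AB; rewrite -[A]mul1mx -[B]mul1mx -J1 !mulmx_suml.
by apply: eq_bigr => p pcs; rewrite -!mulmxA AB.
Qed.

(** Pythagoras: the decomposition of the identity is inserted into the trace of [U U^*]. *)
Lemma fro2_resolution N (a : P -> nat) (J : forall p, 'M[C]_(N, a p)) n
    (U : 'M[C]_(N, n)) : resolution J ->
  fro2 U = \sum_(p in cs) fro2 ((J p)^T *m U).
Proof.
move=> [_ _ J1 JC]; apply: complexI; rewrite [RHS]rmorph_sum /= [LHS]fro2_trace.
rewrite -[U *m _]mul1mx -J1 mulmx_suml raddf_sum; apply: eq_bigr => p _.
rewrite fro2_trace adjmxM -(JC p) trmxCK !mulmxA -[RHS]mxtrace_mulC.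
by rewrite !mulmxA.
Qed.

Section Block.
Variables (M N : nat) (a b : P -> nat).
Variables (J : forall p, 'M[C]_(M, a p)) (K : forall p, 'M[C]_(N, b p)).
Hypotheses (HJ : resolution J) (HK : resolution K).

Lemma block_diag_row W q : q \in cs ->
  (J q)^T *m block_diag J K W = W q *m (K q)^T.
Proof.
case: HJ => Jn Jo _ _ qcs; rewrite mulmx_sumr (bigD1 q)//= big1 => [|p /andP[pcs pq]].
  by rewrite addr0 !mulmxA Jn// mul1mx.
by rewrite !mulmxA Jo 1?eq_sym// !mul0mx.
Qed.

Lemma fro2_block_diag_le W c n (x : 'M[C]_(N, n)) :
  (forall p, p \in cs -> forall v : 'M[C]_(b p, n), fro2 (W p *m v) <= c * fro2 v) ->
  fro2 (block_diag J K W *m x) <= c * fro2 x.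
Proof.
move=> Wc; rewrite (fro2_resolution _ HJ) (fro2_resolution x HK) mulr_sumr.
by apply: ler_sum => p pcs; rewrite mulmxA block_diag_row// -mulmxA Wc.
Qed.

End Block.

Section Scalar.
Variables (N : nat) (a : P -> nat) (J : forall p, 'M[C]_(N, a p)).
Hypothesis HJ : resolution J.

Definition scalar_diag (g : P -> C) := block_diag J J (fun p => (g p)%:M).

Lemma scalar_diag_row g q : q \in cs ->
  (J q)^T *m scalar_diag g = g q *: (J q)^T.
Proof. by move=> qcs; rewrite block_diag_row// mul_scalar_mx. Qed.

Lemma scalar_diag_unit g : (forall p, g p != 0) ->
  scalar_diag g \in unitmx.
Proof.
move=> g0.
have gg : scalar_diag (fun p => (g p)^-1) *m scalar_diag g = 1%:M.
  apply: (resolution_ext HJ) => p pcs.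
  rewrite mulmxA scalar_diag_row// -scalemxAl scalar_diag_row//.
  by rewrite scalerA mulVf// scale1r mulmx1.
by case: (mulmx1_unit gg).
Qed.

Lemma fro2_scalar_diag g n (U : 'M[C]_(N, n)) :
  fro2 (scalar_diag g *m U) =
  \sum_(p in cs) complex.Re `|g p| ^+ 2 * fro2 ((J p)^T *m U).
Proof.
rewrite (fro2_resolution _ HJ); apply: eq_bigr => p pcs.
by rewrite mulmxA scalar_diag_row// -scalemxAl fro2Z.
Qed.

End Scalar.

(** Both sides have [p]-th block row [g p *: (W p *m (K p)^T)]. This puts the pairs of scalar
    diagonals with common weights into the commutant. *)
Lemma block_diag_scalar_comm M N (a b : P -> nat) (J : forall p, 'M[C]_(M, a p))
    (K : forall p, 'M[C]_(N, b p)) W g : resolution J -> resolution K ->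
  block_diag J K W *m scalar_diag K g = scalar_diag J g *m block_diag J K W.
Proof.
move=> HJ HK; apply: (resolution_ext HJ) => p pcs.
rewrite !mulmxA block_diag_row// scalar_diag_row// -mulmxA scalar_diag_row//.
by rewrite -scalemxAl block_diag_row// scalemxAr.
Qed.

(** Makes the lemmas on [block_diag] available for the enhanced structure. *)
Lemma resolution_tens k N (a : P -> nat) (J : forall p, 'M[C]_(N, a p)) :
  resolution J -> resolution (fun p => (1%:M : 'M[C]_k) *t J p).
Proof.
have tens1 n : (1%:M : 'M[C]_k) *t (1%:M : 'M[C]_n) = 1%:M.
  apply/matrixP => x y; case: (mxtens_indexP x) => i r; case: (mxtens_indexP y) => j s.
  by rewrite tensmxE !mxE -natrM mulnb (can_eq (@mxtens_indexK k n)).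
move=> [Jn Jo J1 JC]; split.
- by move=> p pcs; rewrite trmx_tens tensmx_mul trmx1 mul1mx Jn.
- by move=> p q pcs qcs pq; rewrite trmx_tens tensmx_mul Jo// tensmx0.
- rewrite -tens1 -J1; apply/matrixP => x y.
  rewrite summxE mxE summxE mulr_sumr; apply: eq_bigr => p _.
  by rewrite trmx_tens tensmx_mul trmx1 mul1mx mxE.
move=> p; apply/matrixP => x y; rewrite !mxE rmorphM /= conjC_nat.
have /matrixP/(_ (mxtens_unindex x).2 (mxtens_unindex y).2) := JC p.
by rewrite !mxE => ->.
Qed.

Lemma exists_destabilizing_block M N (a b : P -> nat) (J : forall p, 'M[C]_(M, a p))
    (K : forall p, 'M[C]_(N, b p)) (u : 'cV[C]_M) (v : 'cV[C]_N) (c : R) :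
  resolution J -> resolution K -> 0 <= c ->
  (forall p, p \in cs -> fro2 ((J p)^T *m u) <= c ^+ 2 * fro2 ((K p)^T *m v)) ->
  exists W, block_diag J K W *m v = u /\ opnorm (block_diag J K W) <= c.
Proof.
move=> HJ HK c0 le_uv.
(* With [w = (K p)^T *m v], this rank-one block sends [w] to the [p]-th component of [u], and its
   norm is the ratio of their lengths. If [w = 0], the inverse is 0 and so is the block; the
   hypothesis then makes that component of [u] vanish too. *)
pose W p := (fro2 ((K p)^T *m v))^-1%:C *:
  ((J p)^T *m u *m ((K p)^T *m v) ^t*).
exists W; split.
  apply: (resolution_ext HJ) => p pcs.
  rewrite mulmxA block_diag_row// -mulmxA /W -scalemxAl -mulmxA.
  set w := (K p)^T *m v.
  have -> : w ^t* *m w = (fro2 w)%:C%:M.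
    rewrite [LHS]mx11_scalar; congr (_%:M).
    by rewrite -(fro2_adj w) fro2_trace trmxCK /mxtrace big_ord1.
  rewrite mul_mx_scalar scalerA -rmorphM /=.
  have [w0|w0] := eqVneq (fro2 w) 0; last by rewrite mulVf// scale1r.
  rewrite w0 mulr0 scale0r; apply/esym/eqP; rewrite -fro2_eq0 eq_le fro2_ge0 andbT.
  by have := le_uv p pcs; rewrite -/w w0 mulr0.
apply: opnorm_le => // x; apply: fro2_block_diag_le => // p pcs y.
rewrite /W -scalemxAl fro2ZR; set w := (K p)^T *m v.
have [w0|w0] := eqVneq (fro2 w) 0.
  by rewrite w0 invr0 expr0n mul0r mulr_ge0 ?sqr_ge0 ?fro2_ge0.
have wgt : 0 < fro2 w by rewrite lt_def w0 fro2_ge0.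
rewrite -mulmxA exprVn ler_pdivrMl ?exprn_gt0//.
apply: le_trans (fro2M _ _) _.
apply: le_trans (_ : fro2 ((J p)^T *m u) * (fro2 w * fro2 y) <= _).
  by rewrite ler_wpM2l ?fro2_ge0// -(fro2_adj w) fro2M.
apply: le_trans (_ : (c ^+ 2 * fro2 w) * (fro2 w * fro2 y) <= _).
  by rewrite ler_wpM2r ?mulr_ge0 ?fro2_ge0// le_uv.
by rewrite le_eqVlt; apply/orP; left; apply/eqP; ring.
Qed.

End Resolution.

(** The hypotheses say that the sets [F p] partition [I]: distinct inclusions have orthogonal
    ranges, and [incl R (F p) *m (incl R (F p))^T] is the diagonal indicator of [F p]. *)
Lemma resolution_incl (R : realType) (P I : finType) (cs : {set P}) (F : P -> {set I}) :
  (forall i, exists2 p, p \in cs & i \in F p) ->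
  (forall p q i, p \in cs -> q \in cs -> i \in F p -> i \in F q -> p = q) ->
  resolution cs (fun p => incl R (F p)).
Proof.
move=> cover triv.
have dot p q (l : 'I_#|F p|) (r : 'I_#|F q|) :
    ((incl R (F p))^T *m incl R (F q)) l r = (enum_val l == enum_val r)%:R.
  rewrite mxE (bigD1 (enum_rank (enum_val l)))//= big1 => [|k kl].
    by rewrite !mxE enum_rankK eqxx mul1r addr0.
  rewrite !mxE (_ : _ == enum_val l = false) ?mul0r//.
  by apply/negbTE; apply: contra kl => /eqP <-; rewrite enum_valK.
split.
- move=> p pcs; apply/matrixP => l r; rewrite dot !mxE.
  by rewrite (inj_eq enum_val_inj).
- move=> p q pcs qcs pq; apply/matrixP => l r; rewrite dot mxE.
  case: eqP => // lr; move: pq; rewrite (triv p q (enum_val l)) ?eqxx ?enum_valP//.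
  by rewrite lr enum_valP.
- apply/matrixP => x y; rewrite summxE mxE.
  have [p0 p0cs xp] := cover (enum_val x).
  have ent p : (incl R (F p) *m (incl R (F p))^T) x y =
      ((enum_val x \in F p) && (x == y))%:R.
    rewrite mxE; case: (boolP (enum_val x \in F p)) => xF; last first.
      apply: big1 => l _; rewrite !mxE (_ : enum_val x == _ = false) ?mul0r//.
      by apply/negbTE; apply: contra xF => /eqP ->; exact: enum_valP.
    rewrite (bigD1 (enum_rank_in xF (enum_val x)))//= big1 => [|l lx].
      rewrite !mxE enum_rankK_in// eqxx mul1r addr0.
      by rewrite (inj_eq enum_val_inj) eq_sym.
    rewrite !mxE (_ : enum_val x == _ = false) ?mul0r//.
    apply/negbTE; apply: contra lx => /eqP xl.
    by rewrite -(inj_eq enum_val_inj) enum_rankK_in// xl.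
  rewrite (bigD1 p0)//= big1 => [|p /andP[pcs pp0]].
    by rewrite ent xp addr0.
  rewrite ent; case: (boolP (_ \in F p)) => // xFp.
  by rewrite (triv p p0 _ pcs p0cs xFp xp) eqxx in pp0.
by move=> p; apply/matrixP => x y; rewrite !mxE conjC_nat.
Qed.

(** * The structured singular value *)

Section Components.
Variables (S T : finType) (e : rel (S + T)%type).
Hypothesis e_sym : symmetric e.

Lemma components_partition : finset.partition (components e) [set: (S + T)%type]%SET.
Proof.
apply: equivalence_partitionP => x y z _ _ _; split=> [|xy]; first exact: connect0.
exact: (same_connect (sym_connect_sym e_sym) xy).
Qed.

Lemma components_cover x : exists2 p, p \in components e & x \in p.
Proof.
have := finset.cover_partition components_partition.
by move=> /setP/(_ x); rewrite inE => /bigcupP.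
Qed.

Lemma components_eq p q x : p \in components e -> q \in components e ->
  x \in p -> x \in q -> p = q.
Proof.
have /and3P[_ triv _] := components_partition.
by move=> pc qc xp xq; rewrite -(def_pblock triv pc xp) (def_pblock triv qc xq).
Qed.

Variable R : realType.

Lemma resolution_sources :
  resolution (components e) (fun p => incl R (sources p)).
Proof.
apply: resolution_incl => [s|p q s pc qc].
  by have [p pc sp] := components_cover (inl s); exists p; rewrite ?inE.
by rewrite !inE; exact: components_eq.
Qed.

Lemma resolution_ranges :
  resolution (components e) (fun p => incl R (ranges p)).
Proof.
apply: resolution_incl => [s|p q s pc qc].
  by have [p pc sp] := components_cover (inr s); exists p; rewrite ?inE.
by rewrite !inE; exact: components_eq.
Qed.

Lemma structure_block p B : p \in components e ->
  @structure R S T e (incl R (sources p) *m B *m (incl R (ranges p))^T).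
Proof.
move=> pc; set Z := _ *m _.
have [Jn Jo _ _] := resolution_sources; have [Kn _ _ _] := resolution_ranges.
(* Compressing [Z] to every block gives [B] at [p] and 0 elsewhere, without casting [B] between the
   dimensions of different blocks. *)
exists (fun q => (incl R (sources q))^T *m Z *m incl R (ranges q)) => //.
rewrite (bigD1 p)//= big1 => [|q /andP[qc qp]].
  by rewrite addr0 /Z !mulmxA -[_ *m _ *m incl R (sources p)]mulmxA Jn// mulmx1
    -[_ *m _ *m incl R (ranges p)]mulmxA Kn// mulmx1.
by rewrite /Z !mulmxA -[_ *m _ *m incl R (sources p)]mulmxA Jo// mulmx0 !mul0mx.
Qed.

(** Each block of [W] is expanded into terms [delta_mx i j *t B]; the second factor, carried to the
    full spaces, lies in the structure by [structure_block] and is intertwined by [XY]. *)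
Lemma commutant_tens XY W : commutant (@structure R S T e) XY ->
  @enhanced_structure R S T e W ->
  W *m ((1%:M : 'M_#|S|) *t XY.1) = ((1%:M : 'M_#|S|) *t XY.2) *m W.
Proof.
move=> XYc [V _ <-]; rewrite mulmx_suml mulmx_sumr; apply: eq_bigr => p pc.
rewrite (tens_blocks (V p)) !(mulmx_sumr, mulmx_suml); apply: eq_bigr => i _.
rewrite !(mulmx_sumr, mulmx_suml); apply: eq_bigr => j _.
rewrite trmx_tens !tensmx_mul trmx1 !mulmx1 !mul1mx.
by congr (_ *t _); apply: XYc; exact: structure_block.
Qed.

End Components.

(** * Fixed vectors and amplification *)

Section Fixpoints.
Variable R : realType.
Local Notation C := R[i].

Lemma spectrum1P n (A : 'M[C]_n) :
  spectrum A 1 <-> exists2 v : 'cV_n, v != 0 & A *m v = v.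
Proof.
split; rewrite /spectrum /=.
  (* [kermx] is a left kernel, hence the transposition to reach column vectors. *)
  rewrite -unitmx_tr -row_free_unit -kermx_eq0 => /rowV0Pn[v /sub_kermxP vA v0].
  exists v^T; first by rewrite trmx_eq0.
  apply/eqP; rewrite -subr_eq0 -opprB oppr_eq0.
  rewrite -[X in X - _]mul1mx -mulmxBl -[_ *m _]trmxK trmx_mul trmxK vA.
  by rewrite trmx0.
move=> [v v0 Av]; apply/negP => uA; move: v0.
by rewrite -[v](mulKmx uA) mulmxBl mul1mx Av subrr mulmx0 eqxx.
Qed.

Lemma fro2_tens k m n (A : 'M[C]_(m, n)) (u : 'cV[C]_(k * n)) :
  fro2 (((1%:M : 'M_k) *t A) *m u) <= opnorm A ^+ 2 * fro2 u.
Proof. by rewrite -!fro2_unvec unvec_tens fro2_opnorm. Qed.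

(** Repeating a vector in all columns lets an inequality on square matrices be tested on a single
    vector. *)
Lemma fro2_replicate m n (z : 'cV[C]_m) :
  fro2 (z *m (const_mx 1 : 'rV_n)) = n%:R * fro2 z.
Proof.
rewrite fro2_col -[in RHS](card_ord n) mulr_natl -sumr_const.
apply: eq_bigr => j _; congr fro2; apply/colP => i.
by rewrite !mxE big_ord1 mxE mulr1.
Qed.

End Fixpoints.

(** * The two inequalities *)

Section MainProof.
Variables (R : realType) (S T : finType) (e : rel (S + T)%type).
Hypothesis e_sym : symmetric e.
Variable M : 'M[R[i]]_(#|T|, #|S|).
Local Notation tM := ((1%:M : 'M[R[i]]_#|S|) *t M).
Local Notation cs := (components e).
Local Notation J := (fun p => incl R (sources p)).
Local Notation K := (fun p => incl R (ranges p)).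

(** If [v] is fixed by [tM *m W], intertwining makes [z], the image of [v] under [1 (x) X], a
    nonzero fixed vector of [(1 (x) X M Y^-1) W]; comparing norms of [z] gives the bound. *)
Lemma destabilizing_opnorm_ge W XY :
  destabilizing (@enhanced_structure R S T e) tM W ->
  commutant (@structure R S T e) XY -> XY.1 \in unitmx -> XY.2 \in unitmx ->
  1 <= opnorm (XY.1 *m M *m invmx XY.2) * opnorm W.
Proof.
case: XY => X Y /= [We /spectrum1P[v v0 Wv]] XYc Xu Yu.
have WX := commutant_tens e_sym XYc We; rewrite /= in WX.
pose z := ((1%:M : 'M_#|S|) *t X) *m v.
have zE : ((1%:M : 'M_#|S|) *t (X *m M *m invmx Y)) *m (W *m z) = z.
  rewrite /z (mulmxA W) WX !mulmxA tensmx_mul mulmx1 mulmxKV//.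
  by rewrite -[in RHS]Wv !mulmxA tensmx_mul mulmx1.
have z0 : z != 0.
  apply: contra v0 => /eqP z_0; apply/eqP.
  have : ((1%:M : 'M_#|S|) *t invmx X) *m z = 0 by rewrite z_0 mulmx0.
  rewrite /z mulmxA tensmx_mul mulmx1 mulVmx// => h.
  have h2 := congr1 (@unvec _ _ _) h; rewrite unvec_tens mul1mx in h2.
  by rewrite -[v]unvecK h2; apply/colP => l; rewrite !mxE.
have fz : 0 < fro2 z by rewrite fro2_gt0.
have le1 : fro2 z <= (opnorm (X *m M *m invmx Y) * opnorm W) ^+ 2 * fro2 z.
  rewrite -{1}zE (le_trans (fro2_tens _ _))// exprMn -[leRHS]mulrA.
  by rewrite ler_wpM2l ?sqr_ge0// fro2_opnorm.
rewrite -(@expr_ge1 _ 2) ?mulr_ge0 ?opnorm_ge0//.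
by rewrite -(ler_pM2r fz) mul1r.
Qed.

Lemma destabilizing_exists (b : R) (U : 'M[R[i]]_#|S|) : 0 < b -> U != 0 ->
  (forall p, p \in cs ->
    b ^+ 2 * fro2 ((J p)^T *m U) <= fro2 ((K p)^T *m M *m U)) ->
  exists2 W, destabilizing (@enhanced_structure R S T e) tM W
    & opnorm W <= b^-1.
Proof.
move=> b0 U0 bU.
have tJ := resolution_tens #|S| (resolution_sources e_sym R).
have tK := resolution_tens #|S| (resolution_ranges e_sym R).
have [||W [Wu Wb]] := @exists_destabilizing_block _ _ _ _ _ _ _ _ _
  (vec U) (tM *m vec U) b^-1 tJ tK.
- by rewrite invr_ge0 ltW.
- move=> p pc /=; rewrite !trmx_tens !trmx1 -!fro2_unvec !unvec_tens vecK mulmxA.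
  by rewrite exprVn ler_pdivlMl ?exprn_gt0// bU.
exists (block_diag cs (fun p => (1%:M : 'M_#|S|) *t J p)
          (fun p => (1%:M : 'M_#|S|) *t K p) W) => //; split.
  by exists W.
(* [W] sends [tM *m vec U] to [vec U], so this vector is fixed by [tM *m W], and it is nonzero
   because [U] is. *)
apply/spectrum1P; exists (tM *m vec U); last by rewrite -mulmxA Wu.
apply: contra U0 => /eqP u0; rewrite u0 mulmx0 in Wu.
by rewrite -[U]vecK -Wu; apply/eqP/matrixP => i j; rewrite !mxE.
Qed.

Lemma mu_hat_le (b : R) : 0 < b ->
  (forall U : 'M[R[i]]_#|S|, U != 0 -> exists2 p, p \in cs &
     fro2 ((K p)^T *m M *m U) < b ^+ 2 * fro2 ((J p)^T *m U)) ->
  mu_hat (@structure R S T e) M <= b.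
Proof.
move=> b0 neg.
have HJ := resolution_sources e_sym R; have HK := resolution_ranges e_sym R.
have [d [d0 dU]] := @gram_s_procedure _ _ _ cs _ _
  (fun p => (K p)^T *m M) (fun p => (J p)^T) _ neg.
(* Square roots, because [fro2_scalar_diag] squares the moduli: the weights [d p] reappear in the
   norms. *)
pose g p : R[i] := (Num.sqrt (d p))%:C.
have g2 p : complex.Re `|g p| ^+ 2 = d p.
  by rewrite sqr_Re_norm /= expr0n addr0 sqr_sqrtr ?ltW.
have g0 p : g p != 0.
  rewrite -normr_eq0 -ReE_norm -[0]/(0%:C) (inj_eq (@complexI R)).
  by rewrite -sqrf_eq0 g2 gt_eqF.
have Xu := scalar_diag_unit HK g0; have Yu := scalar_diag_unit HJ g0.
pose X := scalar_diag cs K g; pose Y := scalar_diag cs J g.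
apply: (@le_trans _ _ (opnorm (X *m M *m invmx Y))).
  apply: ge_inf; first by exists 0 => _ [XY _ <-]; exact: opnorm_ge0.
  exists (X, Y) => //; split=> // W [V _ <-] /=.
  exact: block_diag_scalar_comm.
apply: opnorm_le => [|v]; first exact: ltW.
(* The replication below introduces a factor [#|S|], which can be cancelled only if it is
   nonzero. *)
have [S0|S0] := posnP #|S|.
  have -> : v = 0 by apply/colP => k; have := leq_trans (ltn_ord k) (eq_leq S0).
  by rewrite mulmx0 !fro2_0 mulr0.
(* Writing [v = Y z] turns the claim into [|X M z|^2 <= b^2 |Y z|^2], the weighted inequality at
   [z]. *)
rewrite -{2}[v](mulKVmx Yu) -!mulmxA; set z := invmx Y *m v.
rewrite -/Y -/z !fro2_scalar_diag//.
have rep (a : {set (S + T)%type} -> nat) (A : forall p, 'M[R[i]]_(a p, #|S|)) :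
    \sum_(p in cs) d p * fro2 (A p *m (z *m (const_mx 1 : 'rV_#|S|))) =
    #|S|%:R * \sum_(p in cs) complex.Re `|g p| ^+ 2 * fro2 (A p *m z).
  rewrite mulr_sumr; apply: eq_bigr => p _.
  by rewrite mulmxA fro2_replicate g2 mulrCA.
have := dU (z *m const_mx 1).
rewrite !rep mulrCA ler_pM2l ?ltr0n//.
by congr (_ <= _); apply: eq_bigr => p _; rewrite mulmxA.
Qed.

End MainProof.

Theorem theorem6p1 (R : realType) (S T : finType) (e : rel (S + T)%type)
    (he : bipartite e) (hc : complete_components e)
    (M : 'M[R[i]]_(#|T|, #|S|)) :
  mu (@enhanced_structure R S T e) ((1%:M : 'M[R[i]]_#|S|) *t M)
  = mu_hat (@structure R S T e) M.
Proof.
have [e_sym _ _] := he.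
set tM := _ *t M; set D := destabilizing (@enhanced_structure R S T e) tM.
(* Nonemptiness of [D] matters twice: it forces [nu] to be nonzero and makes the infimum a genuine
   one. *)
have inf_ge XY : (D !=set0)%classic -> commutant (@structure R S T e) XY ->
    XY.1 \in unitmx -> XY.2 \in unitmx ->
    let nu := opnorm (XY.1 *m M *m invmx XY.2) in
    0 < nu /\ nu^-1 <= inf [set opnorm W | W in D]%classic.
  move=> [W0 DW0] XYc Xu Yu nu.
  have nu1 W : D W -> 1 <= nu * opnorm W.
    by move=> DW; exact: destabilizing_opnorm_ge DW XYc Xu Yu.
  have nu0 : 0 < nu.
    rewrite lt_def opnorm_ge0 andbT; apply/eqP => nu_0.
    by have := nu1 W0 DW0; rewrite nu_0 mul0r ler10.
  split=> //; apply: lb_le_inf; first by exists (opnorm W0); exists W0.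
  by move=> _ [W DW <-]; rewrite -[nu^-1]mulr1 ler_pdivrMl// nu1.
have comm1 : commutant (@structure R S T e) (1%:M, 1%:M).
  by move=> W _ /=; rewrite mulmx1 mul1mx.
have mu0 : 0 <= mu (@enhanced_structure R S T e) tM.
  rewrite /mu; case: asboolP => // /eqP/set0P D0.
  have [nu0 le_inf] := inf_ge _ D0 comm1 (unitmx1 _ _) (unitmx1 _ _).
  by rewrite divr_ge0// (le_trans _ le_inf)// invr_ge0 ltW.
(* First [mu <= mu_hat]: every admissible pair bounds [mu]. *)
apply/eqP; rewrite eq_le; apply/andP; split.
  apply: lb_le_inf.
    exists (opnorm (1%:M *m M *m invmx 1%:M)).
    by exists (1%:M, 1%:M); rewrite /= ?unitmx1.
  move=> _ [XY [XYc Xu Yu] <-]; rewrite /mu; case: asboolP => [_|/eqP/set0P D0].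
    exact: opnorm_ge0.
  have [nu0 le_inf] := inf_ge _ D0 XYc Xu Yu.
  rewrite div1r -[leRHS]invrK lef_pV2// posrE ?invr_gt0//.
  by rewrite (lt_le_trans _ le_inf)// invr_gt0.
(* Conversely, let [b = mu + eps]. A nonzero [U] violating the hypothesis of [mu_hat_le] would give
   a destabilizing [W] of norm at most [b^-1], hence [b <= mu]. *)
apply/ler_addgt0Pr => eps eps0; set b := _ + eps.
have b0 : 0 < b by rewrite ltr_wpDl.
apply: mu_hat_le => // U U0; apply: contrapT => no.
have [p pc|W DW Wb] := destabilizing_exists e_sym b0 U0 (M := M).
  by rewrite leNgt; apply/negP => lt; apply: no; exists p.
have D0 : (D !=set0)%classic by exists W.
have [nu0 le_inf] := inf_ge _ D0 comm1 (unitmx1 _ _) (unitmx1 _ _).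
have inf0 : 0 < inf [set opnorm W | W in D]%classic.
  by rewrite (lt_le_trans _ le_inf)// invr_gt0.
suff : b <= mu (@enhanced_structure R S T e) tM by rewrite /b gerDl leNgt eps0.
(* The default value 0 is excluded, since [W] lies in [D]. *)
rewrite /mu; case: asboolP => [D_0|_]; first by case: D0 => W1; rewrite /D D_0.
rewrite div1r -[leLHS]invrK lef_pV2 ?posrE ?invr_gt0//.
apply: le_trans Wb; apply: ge_inf; last by exists W.
by exists 0 => _ [V _ <-]; exact: opnorm_ge0.
Qed.
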